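(* Let $X_1,\dots,X_n$ be independent and identically distributed real random variables with distribution function $F$, with order statistics $X_{1:n}\le\cdots\le X_{n:n}$, let $1\le r\le n$ and $1\le k\le n$. Then for any real $t$ and any $x_1,\dots,x_k\le t$, $$P\{X_1\le x_1,\dots,X_k\le x_k,\ X_{r:n}\le t\}=\begin{cases}F(x_1)F(x_2)\cdots F(x_k)\,I_{F(t)}(r-k,n-r+1), & 1\le k<r,\\ F(x_1)F(x_2)\cdots F(x_k), & k\ge r.\end{cases}$$
   Context: $F(x)=P\{X_1\le x\}$; $X_{r:n}$ is the $r$th smallest value among $X_1,\dots,X_n$. For $a,b>0$ and $p\in[0,1]$, $I_p(a,b)=\frac{1}{B(a,b)}\int_0^p u^{a-1}(1-u)^{b-1}\,du$ is the (regularized) incomplete beta function, with $B(a,b)=\int_0^1u^{a-1}(1-u)^{b-1}\,du$. *)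

(* Defs.v *)
From mathcomp Require Export all_boot all_order all_algebra.
From mathcomp Require Export all_classical all_reals all_analysis.

Set Implicit Arguments.
Unset Strict Implicit.
Unset Printing Implicit Defensive.

Import Order.TTheory GRing.Theory Num.Theory.

Local Open Scope classical_set_scope.
Local Open Scope ring_scope.

(* Mutual independence: the product rule holds for every subfamily [J], not
   only for the whole family or for pairs. *)
Definition independent_RVs (d : measure_display) (T : measurableType d)
    (R : realType) (P : probability T R) (I : finType)
    (X : I -> {RV P >-> R}) : Prop :=
  forall (J : {set I}) (B : I -> set R),
    (forall i, measurable (B i)) ->
    P (\bigcap_(i in [set` J]) (X i @^-1` B i)) =
    (\prod_(i in J) P (X i @^-1` B i))%E.

Definition identically_distributed (d : measure_display)
    (T : measurableType d) (R : realType) (P : probability T R) (I : finType)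
    (X : I -> {RV P >-> R}) : Prop :=
  forall (i j : I) (B : set R), measurable B ->
    distribution P (X i) B = distribution P (X j) B.

(* The [r]-th smallest value among [x 0, ..., x n.-1], for [1 <= r <= n]:
   ranks start at 1 while [nth] counts from 0. *)
Definition order_stat (R : realType) (n : nat) (x : 'I_n -> R) (r : nat) : R :=
  nth 0 (sort <=%R [seq x i | i <- enum 'I_n]) r.-1.

(* The library's [beta_fun] only covers natural parameters; this one is for
   real [a, b > 0]. The convention [0 `^ 0 = 1], and the value of the integrand
   at 0 and 1 when an exponent is negative, only concern a null set. *)
Definition beta_int (R : realType) (p a b : R) : R :=
  \int[lebesgue_measure]_(u in `[0, p]) (u `^ (a - 1) * (1 - u) `^ (b - 1)).

Definition beta_function (R : realType) (a b : R) : R := beta_int 1 a b.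

Definition reg_inc_beta (R : realType) (p a b : R) : R :=
  (beta_function a b)^-1 * beta_int p a b.

(* Main.v *)
Require Import Defs.
From mathcomp Require Import all_boot all_order all_algebra.
From mathcomp Require Import all_classical all_reals all_analysis.

Set Implicit Arguments.
Unset Strict Implicit.
Unset Printing Implicit Defensive.

Import Order.TTheory GRing.Theory Num.Theory.
Import numFieldNormedType.Exports.

Local Open Scope classical_set_scope.
Local Open Scope ring_scope.

(** The [r]-th order statistic is at most [t] exactly when at least [r] of the
    variables are ([order_stat_le]). As every bound [x i] is at most [t], the
    event [X i <= x i] for the [k] indices of the first family already makes
    these indices count, so what remains is that at least [r - k] of the other
    [m = n - k] variables are at most [t]. Those are independent of the first
    [k] ones, and the number of them that are at most [t] is binomial with
    parameters [m] and [F t]. Hence the probability is the product of the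
    [F (x i)] and of an upper binomial tail ([prob_bounded_and_count_ge]).

    If [k >= r] the tail starts at 0 and equals 1. Otherwise it is an incomplete
    beta function: the derivative in [p] of the tail
      sum over j >= a of C(m, j) p^j (1 - p)^(m - j)
    telescopes to [a C(m, a) p^(a - 1) (1 - p)^(m - a)] ([deriv_binom_tail]), a
    constant multiple of the integrand of the beta function. The tail vanishes
    at [p = 0], so it is a constant multiple of the incomplete beta integral,
    and since it is 1 at [p = 1] the constant is the normalizing factor
    ([reg_inc_beta_binom_tail]). *)

(** * Order statistics and counting *)

Lemma order_stat_le (R : realType) (n r : nat) (x : 'I_n -> R) (t : R) :
  (1 <= r <= n)%N ->
  (order_stat x r <= t) = (r <= #|[set i | (x i <= t)%R]%SET|)%N.
Proof.
move=> /andP[r_ge1 r_le_n]; rewrite /order_stat.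
set s := sort _ _.
have s_sorted : sorted <=%R s by exact: (sort_sorted (@le_total _ R)).
have size_s : size s = n by rewrite size_sort size_map size_enum_ord.
have -> : #|[set i | (x i <= t)%R]%SET| = count (<= t) s.
  rewrite count_sort count_map enumT cardE [enum _]/enum_mem size_filter.
  by apply: eq_count => i /=; rewrite inE.
have [r_le|lt_r] := leqP r (count (<= t) s).
  by apply: nth_count_le => //; rewrite prednK.
apply/negbTE; rewrite -ltNge; apply: nth_count_gt => //.
by rewrite size_s prednK// r_le_n andbT -ltnS prednK.
Qed.

(** * Binomial tails and the incomplete beta function *)

(** The probability of at least [a] successes in [m] Bernoulli trials, as a
    polynomial in the success probability, so that it can be differentiated
    formally. *)
Definition binom_tail (R : nzRingType) (m a : nat) : {poly R} :=
  \sum_(a <= j < m.+1) ('X^j * (1 - 'X) ^+ (m - j)) *+ 'C(m, j).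

Lemma binom_tail0 (R : comNzRingType) (m : nat) : binom_tail R m 0 = 1.
Proof.
transitivity ((1 - 'X + 'X) ^+ m : {poly R}); last by rewrite subrK expr1n.
rewrite /binom_tail big_mkord.
by rewrite exprDn; apply: eq_bigr => i _; rewrite mulrC.
Qed.

Lemma horner_binom_tail (R : comNzRingType) (m a : nat) (p : R) :
  (binom_tail R m a).[p] =
  \sum_(a <= j < m.+1) (p ^+ j * (1 - p) ^+ (m - j)) *+ 'C(m, j).
Proof.
rewrite horner_sum; apply: eq_bigr => j _.
by rewrite hornerMn !hornerE.
Qed.

Lemma binom_tail_at0 (R : comNzRingType) (m a : nat) :
  (0 < a)%N -> (binom_tail R m a).[0] = 0.
Proof.
move=> a_gt0; rewrite horner_binom_tail big_nat big1// => j /andP[aj _].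
by rewrite expr0n gtn_eqF ?(leq_trans a_gt0)// mul0r mul0rn.
Qed.

Lemma binom_tail_at1 (R : comNzRingType) (m a : nat) :
  (a <= m)%N -> (binom_tail R m a).[1] = 1.
Proof.
move=> a_le_m; rewrite horner_binom_tail big_nat_recr//= big_nat big1.
  by rewrite add0r subnn expr0 mulr1 binn expr1n.
move=> j /andP[_ jm]; rewrite subrr expr0n subn_eq0 leqNgt jm /=.
by rewrite mulr0 mul0rn.
Qed.

(** The [j]-th summand has derivative [u j - u j.+1] for
    [u j = j C(m, j) X^(j - 1) (1 - X)^(m - j)], because
    [(j + 1) C(m, j + 1) = (m - j) C(m, j)]; only [u a] survives, as
    [C(m, m + 1) = 0]. *)
Lemma deriv_binom_tail (R : comNzRingType) (m a : nat) : (0 < a <= m)%N ->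
  (binom_tail R m a)^`() =
  ('X^(a.-1) * (1 - 'X) ^+ (m - a)) *+ (a * 'C(m, a)).
Proof.
move=> /andP[a_gt0 a_le_m].
pose u j : {poly R} := ('X^(j.-1) * (1 - 'X) ^+ (m - j)) *+ (j * 'C(m, j)).
rewrite /binom_tail (raddf_sum (@deriv R)) /=.
rewrite (@telescope_sumr_eq _ _ _ (fun j => - u j)); first last.
- move=> j /andP[_ jm]; rewrite opprK [RHS]addrC /u.
  rewrite derivMn derivM derivXn deriv_exp.
  rewrite derivB derivX -[1]/(1%:P) derivC sub0r mulN1r mulrnAl mulNrn mulrN.
  rewrite mulrnBl -!mulrnA mulrnAr -mulrnA -mul_bin_left.
  by rewrite subnS.
- by rewrite leqW.
by rewrite /u bin_small// muln0 mulr0n oppr0 opprK add0r.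
Qed.

(** By [deriv_binom_tail] both sides have the same derivative in [p], and both
    vanish at 0. *)
Lemma beta_int_binom_tail (R : realType) (m a : nat) (p : R) :
  (0 < a <= m)%N -> 0 <= p <= 1 ->
  beta_int p a%:R (m - a + 1)%:R *+ (a * 'C(m, a)) = (binom_tail R m a).[p].
Proof.
move=> /andP[a_gt0 a_le_m] /andP[p_ge0 p_le1].
pose f : {poly R} := 'X^(a.-1) * (1 - 'X) ^+ (m - a).
have C_gt0 : (0 < a * 'C(m, a))%N by rewrite muln_gt0 a_gt0 bin_gt0.
have -> : beta_int p a%:R (m - a + 1)%:R =
    \int[lebesgue_measure]_(u in `[0, p]) f.[u].
  apply: eq_Rintegral => u; rewrite inE/= in_itv/= => /andP[u_ge0 u_le_p].
  rewrite addn1 -[a in a%:R](prednK a_gt0) -!natr1 !addrK.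
  rewrite !powR_mulrn ?subr_ge0 ?(le_trans u_le_p)//.
  by rewrite /f !hornerE.
(* The fundamental theorem of calculus requires a nondegenerate interval. *)
move: p_ge0; rewrite le_eqVlt => /predU1P[<-|p_gt0].
  by rewrite set_itv1 Rintegral_set1 mul0rn binom_tail_at0.
have N0 : (a * 'C(m, a))%:R != 0 :> R by rewrite pnatr_eq0 -lt0n.
rewrite -[LHS]mulr_natr; apply: (canLR (divfK N0)).
pose G : {poly R} := (a * 'C(m, a))%:R^-1 *: binom_tail R m a.
have G' : G^`() = f.
  rewrite derivZ deriv_binom_tail ?a_gt0// -scalerMnr scalerMnl.
  rewrite -mulr_natr mulVf// scale1r; exact: erefl.
rewrite /Rintegral (@continuous_FTC2 _ (horner f) (horner G)) //.
- by rewrite /= !hornerZ binom_tail_at0// mulr0 subr0 mulrC.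
- by apply/continuous_subspaceT => u; exact: continuous_horner.
- split=> [x _| |]; first exact: derivable_horner.
  + by apply: cvg_at_right_filter; exact: continuous_horner.
  + by apply: cvg_at_left_filter; exact: continuous_horner.
- move=> x _.
  by rewrite derive1E (@derive_val _ _ _ _ _ _ _ (is_derive_poly G x)) G'.
Qed.

(** At [p = 1] the tail is 1, so [beta_int_binom_tail] evaluates the complete
    beta function there; dividing by it cancels the binomial factor. *)
Lemma reg_inc_beta_binom_tail (R : realType) (m a : nat) (p : R) :
  (0 < a <= m)%N -> 0 <= p <= 1 ->
  reg_inc_beta p a%:R (m - a + 1)%:R = (binom_tail R m a).[p].
Proof.
move=> am p01; have /andP[a_gt0 a_le_m] := am.
have C_neq0 : (a * 'C(m, a))%:R != 0 :> R.
  by rewrite pnatr_eq0 -lt0n muln_gt0 a_gt0 bin_gt0.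
have := beta_int_binom_tail am (_ : 0 <= (1 : R) <= 1).
rewrite binom_tail_at1// ler01 lexx => /(_ isT).
rewrite -[LHS]mulr_natr => /(canRL (mulfK C_neq0)).
rewrite div1r /reg_inc_beta /beta_function => ->.
by rewrite invrK mulr_natl beta_int_binom_tail.
Qed.

(** * Independent variables below a threshold *)

Lemma sum_subset_card (V : nmodType) (I : finType) (D : {set I})
    (G : nat -> V) :
  \sum_(B : {set I} | B \subset D) G #|B| =
  \sum_(j < #|D|.+1) G j *+ 'C(#|D|, j).
Proof.
rewrite (partition_big (fun B : {set I} => inord #|B| : 'I_#|D|.+1) xpredT)//=.
apply: eq_bigr => j _; rewrite -(cards_draws D j) -sumr_const.
have eq_j (B : {set I}) : (B \subset D) && (inord #|B| == j) =
    (B \in [set A : {set I} | A \subset D & #|A| == j]%SET).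
  rewrite inE; case BD: (B \subset D) => //=.
  by rewrite -val_eqE/= inordK// ltnS subset_leq_card.
apply: eq_big => // B; rewrite eq_j inE => /andP[_ /eqP ->] //.
Qed.

Lemma measure_fin_partition (d : measure_display) (T : measurableType d)
    (R : realType) (P : {measure set T -> \bar R}) (J : finType) (S : T -> J)
    (E : set T) :
  (forall j, measurable (E `&` S @^-1` [set j])) ->
  P E = (\sum_j P (E `&` S @^-1` [set j]))%E.
Proof.
move=> mE.
have E_cover : E = \bigcup_(j in [set` index_enum J]) (E `&` S @^-1` [set j]).
  apply/seteqP; split=> [w Ew|w [j _ []//]].
  by exists (S w) => //=; rewrite mem_index_enum.
rewrite {1}E_cover measure_fin_bigcup.
- by rewrite -fsbig_seq// index_enum_uniq.
- exact: finite_finset.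
- by move=> i j _ _ [w [[_ <-] [_ <-]]].
- by move=> j _; exact: mE.
Qed.

(** The event is split according to the set [S w] of the indices outside [K]
    whose variable is at most [t]. Each piece prescribes, for every index
    separately, an interval containing the variable, so independence turns its
    probability into a product that depends on the set only through its
    cardinality. The truncated difference [r - #|K|] makes the formula hold also
    for [r <= #|K|], where the tail starts at 0. *)
Lemma prob_bounded_and_count_ge (d : measure_display) (T : measurableType d)
    (R : realType) (P : probability T R) (I : finType) (X : I -> {RV P >-> R})
    (F : R -> R) (X_indep : independent_RVs X)
    (X_F : forall i y, cdf (X i) y = (F y)%:E)
    (K : {set I}) (x : I -> R) (t : R) (r : nat)
    (x_le_t : forall i, i \in K -> x i <= t) :
  P [set w | (forall i, i \in K -> X i w <= x i) /\
             (r <= #|[set i | (X i w <= t)%R]%SET|)%N]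
  = ((\prod_(i in K) F (x i)) *
     (binom_tail R (#|I| - #|K|) (r - #|K|)).[F t])%:E.
Proof.
pose S w := [set i | (i \notin K) && (X i w <= t)%R]%SET.
pose m := (#|I| - #|K|)%N; pose a := (r - #|K|)%N.
have cardK : #|~: K| = m by rewrite cardsCs finset.setCK.
(* Every index of [K] counts, since [X i w <= x i <= t] there. *)
have -> : [set w | (forall i, i \in K -> X i w <= x i) /\
             (r <= #|[set i | (X i w <= t)%R]%SET|)%N] =
    [set w | (forall i, i \in K -> X i w <= x i) /\ (a <= #|S w|)%N].
  suff eq_card w : (forall i, i \in K -> X i w <= x i) ->
      #|[set i | (X i w <= t)%R]%SET| = (#|K| + #|S w|)%N.
    by apply/seteqP; split=> w /= [Xx]; rewrite eq_card// /a leq_subLR.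
  move=> Xx; rewrite -(cardsID K); congr addn; apply: eq_card => i.
    rewrite !inE andbC; case iK : (i \in K) => //=.
    by rewrite (le_trans (Xx _ iK)) ?x_le_t.
  by rewrite !inE.
set E := [set w | _].
pose B (A : {set I}) i : set R := [set` if i \in K then `]-oo, x i]
  else if i \in A then `]-oo, t] else `]t, +oo[ ].
have mB A i : measurable (B A i) by exact: measurable_itv.
(* The values of [S w] that are not sets outside [K], or are too small, do not
   occur on [E]. *)
have fiber (A : {set I}) : E `&` S @^-1` [set A] =
    if (A \subset ~: K) && (a <= #|A|)%N
    then \bigcap_(i in [set` [set: I]%SET]) (X i @^-1` B A i) else set0.
  case: ifPn => [/andP[AK aA]|nA]; last first.
    rewrite -subset0 => w [[Xx aS] /= SA]; case/negP: nA; rewrite -SA aS andbT.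
    by apply/fintype.subsetP => i; rewrite !inE => /andP[].
  apply/seteqP; split=> [w [[Xx aS] /= SA] i _ /=|w XB].
    rewrite /B; case: ifPn => iK; first by rewrite /= in_itv/= Xx.
    have : (i \in A) = (X i w <= t) by rewrite -SA inE iK.
    by case: ifP => _; rewrite /= in_itv/= ?andbT ?ltNge => <-.
  have SA : S w = A.
    apply/setP => i; rewrite inE; have := XB i; rewrite /= inE => /(_ isT).
    rewrite /B; case: ifPn => [iK _|iK]/=.
      apply/esym/negbTE; apply: contraL iK => iA.
      by have := fintype.subsetP AK i iA; rewrite inE.
    case: ifPn => _; rewrite /= in_itv//= andbT => tX.
    by apply/negbTE; rewrite -ltNge.
  split=> //=; split; last by rewrite SA.
  move=> i iK; have := XB i; rewrite /= inE => /(_ isT).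
  by rewrite /B iK /= in_itv.
have P_le i y : P (X i @^-1` `]-oo, y]) = (F y)%:E by rewrite -(X_F i).
have P_gt i : P (X i @^-1` `]t, +oo[) = (1 - F t)%:E.
  by have := ccdf_1_cdf (X i) t; rewrite X_F.
have Pfiber (A : {set I}) : A \subset ~: K -> (a <= #|A|)%N ->
    P (E `&` S @^-1` [set A]) =
    ((\prod_(i in K) F (x i)) * (F t ^+ #|A| * (1 - F t) ^+ (m - #|A|)))%:E.
  move=> AK aA; rewrite fiber AK aA X_indep//.
  pose G i := if i \in K then F (x i) else if i \in A then F t else 1 - F t.
  rewrite (eq_bigr (fun i => (G i)%:E)); last first.
    by move=> i _; rewrite /B /G; case: ifP => _//; case: ifP.
  rewrite prodEFin; congr EFin.
  rewrite (eq_bigl xpredT) => [|i]; last by rewrite inE.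
  rewrite (bigID [in K])/=; congr (_ * _).
    by apply: eq_bigr => i iK; rewrite /G iK.
  rewrite (bigID [in A])/=; congr (_ * _).
    rewrite -prodr_const; apply: eq_big => [i|i /andP[iK iA]].
      have := fintype.subsetP AK i; rewrite inE.
      by case: (i \in A) => [/(_ isT) ->|]; rewrite ?andbF.
    by rewrite /G (negbTE iK) iA.
  have <- : #|~: K :\: A| = (m - #|A|)%N by rewrite cardsDS// cardK.
  rewrite -prodr_const; apply: eq_big => [i|i /andP[iK iA]].
    by rewrite !inE andbC.
  by rewrite /G (negbTE iK) (negbTE iA).
rewrite (@measure_fin_partition _ _ _ P _ S); last first.
  move=> A; rewrite fiber; case: ifP => // _.
  apply: fin_bigcap_measurable => [|i _]; first exact: finite_finset.
  exact: measurable_funPTI.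
rewrite (bigID (fun A : {set I} => (A \subset ~: K) && (a <= #|A|)%N))/=.
rewrite [X in (_ + X)%E]big1 ?adde0; last first.
  by move=> A /negbTE nA; rewrite fiber nA measure0.
rewrite (eq_bigr _ (fun A HA => Pfiber A (andP HA).1 (andP HA).2)).
rewrite sumEFin -mulr_sumr; congr (_ * _)%:E.
pose g j := if (a <= j)%N then F t ^+ j * (1 - F t) ^+ (m - j) else 0.
rewrite big_mkcondr/= (sum_subset_card _ g) cardK horner_binom_tail.
rewrite [RHS]big_geq_mkord [RHS]big_mkcond/=; apply: eq_bigr => j _.
by rewrite /g; case: ifP => //; rewrite mul0rn.
Qed.

(** * Bounds on the first variables and on an order statistic *)

Theorem lemma3 (R : realType) (d : measure_display) (T : measurableType d)
    (P : probability T R) (n : nat) (X : 'I_n -> {RV P >-> R}) (F : R -> R)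
    (X_indep : independent_RVs X)
    (X_ident : identically_distributed X)
    (X_F : forall (i : 'I_n) (y : R), cdf (X i) y = (F y)%:E)
    (r k : nat) (r_ge1 : (1 <= r)%N) (r_le_n : (r <= n)%N)
    (k_ge1 : (1 <= k)%N) (k_le_n : (k <= n)%N)
    (t : R) (x : 'I_k -> R) (x_le_t : forall i : 'I_k, x i <= t) :
  P [set w | (forall i : 'I_k, X (widen_ord k_le_n i) w <= x i) /\
             order_stat (fun i : 'I_n => X i w) r <= t]
  = (if (k < r)%N
     then (\prod_(i < k) F (x i)) *
          reg_inc_beta (F t) (r - k)%:R (n - r + 1)%:R
     else \prod_(i < k) F (x i))%:E.
Proof.
pose K := [set i : 'I_n | (i < k)%N]%SET.
(* The bounds are indexed by all of ['I_n]; the default [t] is only taken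
   outside [K]. *)
pose y (i : 'I_n) := oapp x t (insub (i : nat)).
have yx i : y (widen_ord k_le_n i) = x i by rewrite /y /= valK.
have cardK : #|K| = k.
  rewrite -sum1dep_card (big_ord_narrow k_le_n) sum1_card card_ord //.
have y_le_t i : i \in K -> y i <= t.
  by rewrite /y; case: insub => [j|] _ //=; rewrite x_le_t.
have -> : [set w | (forall i : 'I_k, X (widen_ord k_le_n i) w <= x i) /\
             order_stat (fun i : 'I_n => X i w) r <= t] =
    [set w | (forall i, i \in K -> X i w <= y i) /\
             (r <= #|[set i | (X i w <= t)%R]%SET|)%N].
  apply/seteqP; split=> w /=; rewrite order_stat_le ?r_ge1//.
    move=> [Xx ?]; split=> // i.
    rewrite inE => ik; have := Xx (Ordinal ik); rewrite -yx.
    by have -> : widen_ord k_le_n (Ordinal ik) = i by exact: val_inj.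
  move=> [Xx ?]; split=> // i.
  by rewrite -yx; apply: Xx; rewrite inE /=.
rewrite (prob_bounded_and_count_ge X_indep X_F r y_le_t) cardK card_ord.
have -> : \prod_(i in K) F (y i) = \prod_(i < k) F (x i).
  rewrite (eq_bigl (fun i : 'I_n => (i < k)%N)) => [|i]; last by rewrite inE.
  by rewrite (big_ord_narrow k_le_n); apply: eq_bigr => i _; rewrite yx.
congr EFin; case: ltnP => [k_lt_r|r_le_k]; last first.
  by rewrite (eqP r_le_k) binom_tail0 hornerC mulr1.
have F01 : 0 <= F t <= 1.
  rewrite -!lee_fin -(X_F (Ordinal (leq_trans k_ge1 k_le_n))).
  by rewrite measure_ge0 probability_le1.
rewrite -reg_inc_beta_binom_tail//; last by rewrite subn_gt0 k_lt_r leq_sub2r.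
by rewrite subnBA ?subnK// ltnW.
Qed.
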